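(* Let $X$ be a Mackey complete locally convex space and let $(T(t))_{t\geqslant0}$ be a $C_0$-semigroup on $X$. (1) The following are equivalent. (i) $(T(t))_{t\geqslant0}$ is pseudo uniformly exponentially stable. (ii) $\forall\, q\in\Gamma_X\ \exists\,\omega>0\ \forall\, x\in X$: $\lim_{t\to\infty}q(e^{\omega t}T(t)x)=0$. (2) The following are equivalent. (iii) $(T(t))_{t\geqslant0}$ is pseudo strongly exponentially stable. (iv) $\forall\, q\in\Gamma_X,\, B\in\mathcal{B}_X\ \exists\,\omega>0$: $\lim_{t\to\infty}q_B(e^{\omega t}T(t))=0$.
   Context: Locally convex spaces are assumed Hausdorff. For a locally convex space $X$, $\Gamma_X$ denotes a system of continuous seminorms determining the topology of $X$, $L(X)$ is the space of all continuous linear operators $X\to X$, and $\mathcal{B}_X$ is the collection of all bounded subsets of $X$. For $q\in\Gamma_X$, $B\in\mathcal{B}_X$ and $S\in L(X)$ put $q_B(S)=\sup_{x\in B}q(Sx)$. A sequence $(x_n)_{n\in\mathbb{N}}$ in $X$ is Mackey Cauchy if there exist $B\in\mathcal{B}_X$ and scalars $b_{n,k}$ tending to zero as $n$ and $k$ both tend to infinity such that $x_n-x_k\in b_{n,k}B$ for all $n,k\in\mathbb{N}$; $X$ is Mackey complete if every Mackey Cauchy sequence in $X$ converges. A $C_0$-semigroup on $X$ is a family $(T(t))_{t\geqslant0}\subseteq L(X)$ with $T(0)=\mathrm{id}_X$, $T(s+t)=T(s)T(t)$ for all $s,t\geqslant0$, and $\lim_{t\to t_0}T(t)x=T(t_0)x$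 for all $t_0\geqslant0$, $x\in X$. It is pseudo uniformly exponentially stable if $\forall q\in\Gamma_X\ \exists\omega>0\ \forall B\in\mathcal{B}_X$: $\lim_{t\to\infty}q_B(e^{\omega t}T(t))=0$, and pseudo strongly exponentially stable if $\forall q\in\Gamma_X, x\in X\ \exists\omega>0$: $\lim_{t\to\infty}q(e^{\omega t}T(t)x)=0$. *)

(* Defs.v *)
From HB Require Import structures.
From mathcomp Require Import all_boot all_order all_algebra.
From mathcomp Require Import complex.
From mathcomp Require Import boolp classical_sets functions cardinality reals.
From mathcomp Require Import topology normedtype sequences exp.

Set Implicit Arguments.
Unset Strict Implicit.
Unset Printing Implicit Defensive.

Import Order.TTheory GRing.Theory Num.Theory.
Import numFieldNormedType.Exports.

Local Open Scope classical_set_scope.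
Local Open Scope ring_scope.

(* Locally convex spaces are taken over the real or the complex numbers. *)
Variant scalar_kind := real_scalars | complex_scalars.

Definition scalars (R : realType) (k : scalar_kind) : numFieldType :=
  match k with
  | real_scalars => R
  | complex_scalars => R[i]
  end.

Definition scalar_of (R : realType) (k : scalar_kind) : R -> scalars R k :=
  match k with
  | real_scalars => fun r => r
  | complex_scalars => fun r => r%:C%C
  end.

Section LocallyConvexSpace.
Context (R : realType) (k : scalar_kind) (X : tvsType (scalars R k)).
Implicit Types (q : X -> R) (B U : set X) (S : X -> X).

(* The norm of a numFieldType takes its values in the field itself, so
   absolute homogeneity is an equation in [scalars R k]. *)
Record seminorm q : Prop := {
  seminorm_ge0 : forall x, 0 <= q x;
  seminorm_triangle : forall x y, q (x + y) <= q x + q y;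
  seminorm_homogeneous : forall (a : scalars R k) x,
    scalar_of k (q (a *: x)) = `|a| * scalar_of k (q x)
}.

(* Finite intersections of balls of seminorms in [G] form a neighbourhood base
   at 0; [G] is not required to be directed. *)
Record determining_seminorms (G : set (X -> R)) : Prop := {
  determining_seminorm : forall q, G q -> seminorm q;
  determining_continuous : forall q, G q -> continuous q;
  determining_nbhs : forall U, nbhs 0 U ->
    exists F : set (X -> R), exists e : R,
      [/\ finite_set F, F `<=` G, 0 < e &
          [set x | forall q, F q -> q x < e] `<=` U]
}.

Definition von_neumann_bounded B : Prop :=
  forall U, nbhs 0 U ->
    exists2 r : R, 0 < r &
      forall a : scalars R k, scalar_of k r <= `|a| -> B `<=` *:%R a @` U.

Definition mackey_cauchy (x : nat -> X) : Prop :=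
  exists B : set X, exists b : nat -> nat -> scalars R k,
    [/\ von_neumann_bounded B,
        b nm.1 nm.2 @[nm --> (\oo, \oo)] --> (0 : scalars R k) &
        forall n m, ( *:%R (b n m) @` B) (x n - x m)].

Definition mackey_complete : Prop :=
  forall x : nat -> X, mackey_cauchy x -> exists l : X, x @ \oo --> l.

(* For bounded [B] and continuous linear [S] the set is bounded above, so this
   is a true supremum; it is 0 when [B] is empty. *)
Definition sup_on q B S : R := sup [set q (S x) | x in B].

Definition continuous_linear S : Prop := linear S /\ continuous S.

(* [T t] is only constrained, and only used, for [0 <= t]. *)
Record C0_semigroup (T : R -> X -> X) : Prop := {
  C0_continuous_linear : forall t : R, 0 <= t -> continuous_linear (T t);
  C0_id : T 0 = id;
  C0_add : forall s t : R, 0 <= s -> 0 <= t -> T (s + t) = T s \o T t;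
  C0_strong_continuity : forall (t0 : R) (x : X), 0 <= t0 ->
    T t x @[t --> within [set t : R | 0 <= t] (nbhs t0)] --> T t0 x
}.

Definition exp_rescaled (w : R) (T : R -> X -> X) (t : R) (x : X) : X :=
  scalar_of k (expR (w * t)) *: T t x.

Definition pseudo_uniformly_exp_stable (G : set (X -> R)) (T : R -> X -> X) :=
  forall q, G q -> exists2 w : R, 0 < w &
    forall B, von_neumann_bounded B ->
      sup_on q B (exp_rescaled w T t) @[t --> +oo] --> 0.

Definition pseudo_strongly_exp_stable (G : set (X -> R)) (T : R -> X -> X) :=
  forall q x, G q -> exists2 w : R, 0 < w &
    q (exp_rescaled w T t x) @[t --> +oo] --> 0.

End LocallyConvexSpace.

Arguments mackey_complete {R k} X.

(* Main.v *)
(** The implications from bounded sets to points use singletons.  For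
    the converses, suppose that the rates [w n] decrease, that every orbit
    [q (T t x)] is [O(exp (- w n t))] for some [n], but that for no [n] this
    holds uniformly on [B].  Then there are times [t n] such that the continuous
    seminorms [p n x = exp (w n * t n) * q (T (t n) x)] take large values on
    [B], and a gliding hump, whose partial sums are Mackey Cauchy, produces one
    point [x] with [p n x >= n] for all [n], contradicting the decay of its
    orbit.  A constant [w] gives (1), and [w n = 1 / (n + 1)] gives (2); halving
    the rate turns boundedness into convergence to 0. *)
Require Import Defs.
From mathcomp Require Import all_boot all_order all_algebra.
From mathcomp Require Import complex ring lra.
From mathcomp Require Import boolp classical_sets functions cardinality reals.
From mathcomp Require Import topology normedtype sequences exp derive.
Import Order.TTheory GRing.Theory Num.Theory.
Import numFieldNormedType.Exports.
Local Open Scope classical_set_scope.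
Local Open Scope ring_scope.

(** * Embedding of the reals into the scalar field *)

Section Scalars.
Context {R : realType} (k : scalar_kind).
Local Notation sc := (@scalar_of R k).

Lemma scalar_of0 : sc 0 = 0.
Proof. by case: k. Qed.

Lemma scalar_of1 : sc 1 = 1.
Proof. by case: k. Qed.

Lemma scalar_ofN a : sc (- a) = - sc a.
Proof. by case: k => //=; rewrite rmorphN. Qed.

Lemma scalar_ofM a b : sc (a * b) = sc a * sc b.
Proof. by case: k => //=; rewrite rmorphM. Qed.

Lemma ler_scalar_of a b : (sc a <= sc b) = (a <= b).
Proof. by case: k => //=; rewrite lecR. Qed.

Lemma ltr_scalar_of a b : (sc a < sc b) = (a < b).
Proof. by case: k => //=; rewrite ltcR. Qed.

Lemma scalar_of_inj : injective sc.
Proof. by case: k => //= a b []. Qed.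

Lemma norm_scalar_of a : `|sc a| = sc `|a|.
Proof. by case: k => //=; rewrite normc_def /= expr0n addr0 sqrtr_sqr. Qed.

(** Norms live in the scalar field; extracting a real number lets estimates be carried out in
    [R]. *)
Lemma norm_scalarP (a : scalars R k) : exists2 r : R, 0 <= r & `|a| = sc r.
Proof.
case: k a => /= a; first by exists `|a|.
by exists (Num.sqrt (complex.Re a ^+ 2 + complex.Im a ^+ 2));
  rewrite ?sqrtr_ge0 // normc_def.
Qed.

End Scalars.

(** The supremum of [p] on [B] is above [c], hence positive, but need not be attained. Any point
    whose value exceeds both [c] and two thirds of the supremum will do. *)
Lemma near_maximizer {R : realType} {T : Type} (p : T -> R) (B : set T)
    (M c : R) :
  (forall z, B z -> p z <= M) -> 0 <= c -> (exists2 y, B y & c < p y) ->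
  exists y, [/\ B y, c < p y & forall z, B z -> p z <= 3 / 2 * p y].
Proof.
move=> pM c0 [y0 By0 cy0].
set E := [set p z | z in B].
have ubE : has_ubound E by exists M => _ [z Bz <-]; exact: pM.
have supE : has_sup E by split=> //; exists (p y0); exists y0.
have cS : c < sup E.
  by apply: lt_le_trans cy0 _; apply: ub_le_sup => //; exists y0.
set d := Num.max c (2 / 3 * sup E).
have dS : 0 < sup E - d by rewrite subr_gt0 gt_max cS /=; lra.
have [_ [y By <-]] := sup_adherent dS supE.
rewrite subKr gt_max => /andP[cy Sy]; exists y; split=> // z Bz.
have : p z <= sup E by apply: ub_le_sup => //; exists z.
lra.
Qed.

(** * Seminorm estimates over real or complex scalars *)

Section Seminorms.
Context {R : realType} {k : scalar_kind} {X : tvsType (scalars R k)}.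
Implicit Types (p q : X -> R) (B : set X) (x y : X).

Lemma seminormZ p (r : R) x : seminorm p ->
  p (scalar_of k r *: x) = `|r| * p x.
Proof.
move=> [_ _ pZ]; apply: (@scalar_of_inj _ k).
by rewrite pZ norm_scalar_of scalar_ofM.
Qed.

Lemma seminorm0 p : seminorm p -> p 0 = 0.
Proof.
by move=> /(seminormZ _ 0 0); rewrite scaler0 normr0 mul0r.
Qed.

Lemma seminormN p x : seminorm p -> p (- x) = p x.
Proof.
move=> sp; have := seminormZ p (-1) x sp.
by rewrite scalar_ofN scalar_of1 scaleN1r normrN1 mul1r.
Qed.

Lemma seminorm_distC p x y : seminorm p -> p (x - y) = p (y - x).
Proof. by move=> sp; rewrite -(seminormN p _ sp) opprB. Qed.

(** Used to see that [expR (w * t) * q (T t x)] is a seminorm in [x]. *)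
Lemma seminorm_comp p (S : X -> X) (c : R) :
  seminorm p -> linear S -> 0 <= c -> seminorm (fun x => c * p (S x)).
Proof.
move=> [p0 pD pZ] linS c0.
have SZ (a : scalars R k) x : S (a *: x) = a *: S x.
  have S0 : S 0 = 0.
    have := linS 1 0 0; rewrite !scale1r addr0 => /esym/eqP.
    by rewrite -subr_eq0 addrK => /eqP.
  by have := linS a x 0; rewrite S0 !addr0.
split=> [x|x y|a x].
- by rewrite mulr_ge0.
- by have := linS 1 x y; rewrite !scale1r -mulrDr => ->; rewrite ler_wpM2l.
- by rewrite SZ scalar_ofM pZ mulrCA -scalar_ofM.
Qed.

(** The open unit ball of [p] is a neighbourhood of 0, so it absorbs [B]; the absorbing factor is
    the bound. *)
Lemma seminorm_bounded_on p B : seminorm p -> continuous p ->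
  von_neumann_bounded B -> exists2 M : R, 0 <= M & forall x, B x -> p x <= M.
Proof.
move=> sp cp bB.
have : nbhs 0 [set x | p x < 1].
  have cp0 : p z @[z --> (0 : X)] --> p 0 := cp 0.
  rewrite seminorm0 // in cp0.
  exact: (cvgr_lt 0 cp0 1 ltr01).
move=> /bB[r r0 Br]; exists r => [|x Bx]; first exact: ltW.
have [|u /= pu1 <-] := Br (scalar_of k r) _ x Bx.
  by rewrite norm_scalar_of ler_scalar_of ler_norm.
by rewrite seminormZ // gtr0_norm // ler_piMr // ltW.
Qed.

(* Sokal's observation: one of [x + r y], [x - r y] has seminorm at least
   [r p(y)], since their difference is [2 r y]. *)
Lemma seminorm_signed_step p x y (r : R) : seminorm p -> 0 <= r ->
  exists2 s : R, `|s| = r & r * p y <= p (x + scalar_of k s *: y).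
Proof.
move=> sp r0.
have [h|h] := leP (r * p y) (p (x + scalar_of k r *: y)).
  by exists r; rewrite ?ger0_norm.
exists (- r); first by rewrite normrN ger0_norm.
have := seminorm_triangle sp (x + scalar_of k r *: y)
  (- (x + scalar_of k (- r) *: y)).
rewrite seminormN // opprD addrACA subrr add0r scalar_ofN scaleNr opprK.
have -> : scalar_of k r *: y + scalar_of k r *: y =
    scalar_of k r *: y - scalar_of k r *: (- y) by rewrite scalerN opprK.
rewrite -scalerBr opprK -mulr2n seminormZ // ger0_norm //.
have : p (y *+ 2) = 2 * p y.
  rewrite mulr2n -[in LHS](scale1r y) -scalerDl.
  have -> : 1 + 1 = scalar_of k 2 :> scalars R k.
    by case: (k) => //=; rewrite rmorphD rmorph1.
  by rewrite seminormZ // ger0_norm.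
move=> ->; lra.
Qed.

(** Triangle inequality and the geometric series of ratio 1/3, whose full sum is 3/2. *)
Lemma seminorm_geometric_steps p (u : nat -> X) (M : R) : seminorm p ->
  (forall n, p (u n.+1 - u n) <= 3^-1 ^+ n * M) ->
  forall n m, (n <= m)%N -> p (u m - u n) <= 3 / 2 * 3^-1 ^+ n * M.
Proof.
move=> sp pu n m /subnKC <-; set d := (m - n)%N.
have M0 : 0 <= M.
  by have := pu 0; rewrite expr0 mul1r; apply: le_trans; exact: seminorm_ge0.
(* The exact finite geometric sum is kept here, since the final bound is too weak as an induction
   hypothesis. *)
suff h : p (u (n + d)%N - u n) <= 3 / 2 * (3^-1 ^+ n - 3^-1 ^+ (n + d)) * M.
  apply: le_trans h _; rewrite ler_wpM2r // ler_wpM2l ?divr_ge0 //.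
  by rewrite gerBl exprn_ge0 ?invr_ge0.
elim: d => [|d IHd]; first by rewrite addn0 !subrr mulr0 mul0r seminorm0.
rewrite addnS -(subrKA (u (n + d)%N)).
apply: le_trans (seminorm_triangle sp _ _) _.
apply: le_trans (lerD (pu _) IHd) _.
by rewrite exprSr; set a := 3^-1 ^+ n; set b := 3^-1 ^+ (n + d); lra.
Qed.

End Seminorms.

(** * Bounded sets, Mackey Cauchy sequences and the gliding hump *)

Section MackeyCompleteness.
Context {R : realType} {k : scalar_kind} {X : tvsType (scalars R k)}.
Context {G : set (X -> R)} (G_det : determining_seminorms G).
Implicit Types (p q : X -> R) (B : set X) (x y : X).

(** A neighbourhood of 0 involves only finitely many seminorms; if [M] bounds them all on [B] and
    [e] is the radius, scalars of norm above [M / e] absorb [B]. *)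
Lemma seminorm_bounded_bounded B :
  (forall q, G q -> exists M : R, forall x, B x -> q x <= M) ->
  von_neumann_bounded B.
Proof.
move=> qB U /(determining_nbhs G_det)[F [e [/finite_seqP[s ->] sG e0 sU]]].
have [M M0 sM] : exists2 M : R, 0 < M &
    forall q, q \in s -> forall z, B z -> q z <= M.
  elim: s sG {sU} => [|q s IHs] sG; first by exists 1.
  have [q' q's|M M0 sM] := IHs; first by apply: sG; rewrite /= inE q's orbT.
  have Gq : G q by apply: sG; rewrite /= inE eqxx.
  have [N qN] := qB q Gq.
  exists (Num.max M N) => [|q']; first by rewrite lt_max M0.
  rewrite inE => /predU1P[->|q's] z Bz; rewrite le_max.
    by rewrite qN ?orbT.
  by rewrite (sM q').
have Me : 0 < M / e by rewrite divr_gt0.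
(* The summand 1 makes the inequality strict, as the open ball of radius [e] requires. *)
exists (M / e + 1) => [|a ra z Bz]; first by rewrite addr_gt0.
have [r r0 ar] := norm_scalarP k a.
rewrite ar ler_scalar_of in ra.
have rgt : M / e < r by apply: lt_le_trans ra; rewrite ltrDl.
have a0 : a != 0.
  apply: contraTneq rgt => a0; rewrite -leNgt.
  move: ar; rewrite a0 normr0 -(scalar_of0 k) => /scalar_of_inj <-.
  exact: ltW.
exists (a^-1 *: z); last by rewrite scalerA divff // scale1r.
apply: sU => q /= qs.
have sq := determining_seminorm G_det (sG q qs).
have : r * q (a^-1 *: z) = q z.
  apply: (@scalar_of_inj _ k); rewrite scalar_ofM -ar.
  by rewrite -(seminorm_homogeneous sq) scalerA divff // scale1r.
move=> rq; rewrite -(ltr_pM2l (lt_trans Me rgt)) rq.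
by apply: le_lt_trans (sM _ qs _ Bz) _; rewrite -ltr_pdivrMr.
Qed.

Lemma von_neumann_bounded1 x : von_neumann_bounded [set x].
Proof. by apply: seminorm_bounded_bounded => q _; exists (q x) => _ ->. Qed.

(** Plays the role of the absolutely convex hull of [B], with membership tested one seminorm at a
    time. *)
Definition seminorm_hull B : set X :=
  [set z | forall q (M : R), G q -> 0 <= M -> (forall x, B x -> q x <= M) ->
    q z <= M].

Lemma seminorm_hull_bounded B :
  von_neumann_bounded B -> von_neumann_bounded (seminorm_hull B).
Proof.
move=> bB; apply: seminorm_bounded_bounded => q Gq.
have [M M0 qM] := seminorm_bounded_on q B (determining_seminorm G_det Gq)
  (determining_continuous G_det Gq) bB.
by exists M => z; apply.
Qed.

(** Differences of terms, divided by a bound for the geometric tail, stay in the bounded set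
    [seminorm_hull B]. *)
Lemma mackey_cauchy_geometric B (u y : nat -> X) (s : nat -> R) :
  von_neumann_bounded B -> (forall n, B (y n)) ->
  (forall n, `|s n| = 3^-1 ^+ n) ->
  (forall n, u n.+1 - u n = scalar_of k (s n) *: y n) ->
  mackey_cauchy u.
Proof.
move=> bB By sn us.
(* Sum of the geometric tail starting at the smaller index. *)
pose c n m : R := 3 / 2 * 3^-1 ^+ minn n m.
have c0 n m : 0 < c n m by rewrite mulr_gt0 ?divr_gt0 ?exprn_gt0 ?invr_gt0.
exists (seminorm_hull B), (fun n m => scalar_of k (c n m)); split.
- exact: seminorm_hull_bounded.
- apply/cvgr0Pnorm_lt => eps eps0.
  (* A positive scalar equals its norm, so the tolerance is a real number. *)
  have [r r0 er] := norm_scalarP k eps; rewrite gtr0_norm // in er.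
  rewrite er -(scalar_of0 k) ltr_scalar_of in eps0.
  have /cvgr0Pnorm_lt/(_ _ eps0)[N _ gN] :
      geometric (3 / 2 : R) 3^-1 n @[n --> \oo] --> 0.
    by apply: cvg_geometric; rewrite gtr0_norm ?invf_lt1 ?invr_gt0 ?ltr1n.
  exists ([set n | (N <= n)%N], [set n | (N <= n)%N]).
    by split; exists N.
  move=> [n m] [/= Nn Nm]; rewrite norm_scalar_of er ltr_scalar_of.
  by apply: gN; rewrite /= leq_min Nn.
- move=> n m; exists (scalar_of k (c n m)^-1 *: (u n - u m)); last first.
    by rewrite scalerA -scalar_ofM divff ?gt_eqF // scalar_of1 scale1r.
  move=> q M Gq M0 qM; have sq := determining_seminorm G_det Gq.
  rewrite seminormZ // gtr0_norm ?invr_gt0 // ler_pdivrMl //.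
  have step i : q (u i.+1 - u i) <= 3^-1 ^+ i * M.
    by rewrite us seminormZ // sn ler_wpM2l ?exprn_ge0 ?invr_ge0 // qM.
  have geo := seminorm_geometric_steps q u M sq step.
  have [nm|/ltnW mn] := leqP n m.
    by rewrite seminorm_distC // /c (minn_idPl nm); exact: geo.
  by rewrite /c (minn_idPr mn); exact: geo.
Qed.

(* Sokal's gliding hump: [u (n+1) = u n + s_n y_n] with [|s_n| = 3^-n], where
   [y_n] nearly maximizes [p n] on [B] and the sign of [s_n] makes
   [p n (u (n+1)) >= 3^-n p n (y_n)]; all later steps change [p n] by at most
   [3/4] of that amount. *)
Lemma gliding_hump (p : nat -> X -> R) (c : nat -> R) B :
  mackey_complete X -> (forall n, seminorm (p n)) ->
  (forall n, continuous (p n)) -> von_neumann_bounded B ->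
  (forall n, 0 <= c n) ->
  (forall n, exists2 y, B y & 4 * 3 ^+ n * c n < p n y) ->
  exists x, forall n, c n <= p n x.
Proof.
move=> mcX sp cp bB c0 large.
have /choice[y yP] n : exists y, [/\ B y, 4 * 3 ^+ n * c n < p n y &
    forall z, B z -> p n z <= 3 / 2 * p n y].
  have [M _ pM] := seminorm_bounded_on _ _ (sp n) (cp n) bB.
  apply: near_maximizer (large n); first exact: pM.
  by rewrite !mulr_ge0 ?exprn_ge0.
(* The sign depends on the partial sum already reached, so it is chosen for every pair of an index
   and a point before the recursion defines [u]. *)
have /choice[s sP] (nx : nat * X) : exists s : R, `|s| = 3^-1 ^+ nx.1 /\
    3^-1 ^+ nx.1 * p nx.1 (y nx.1) <=
      p nx.1 (nx.2 + scalar_of k s *: y nx.1).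
  have [|s s1 s2] := seminorm_signed_step (p nx.1) nx.2 (y nx.1)
    (3^-1 ^+ nx.1) (sp nx.1); first by rewrite exprn_ge0 ?invr_ge0.
  by exists s.
pose u := fix u n : X :=
  if n is m.+1 then u m + scalar_of k (s (m, u m)) *: y m else 0.
have us n : u n.+1 - u n = scalar_of k (s (n, u n)) *: y n.
  by rewrite /= addrAC subrr add0r.
have [|l ul] := mcX u.
  apply: (mackey_cauchy_geometric B u y (fun n => s (n, u n))) => // n.
    by have [] := yP n.
  by have [] := sP (n, u n).
exists l => n.
have pul : p n (u m) @[m --> \oo] --> p n l := cvg_comp _ _ ul (cp n l).
(* The lower bound is shown for every partial sum past step [n] and passes to the limit. *)
apply: (cvgr_to_ge pul); exists n.+1 => // m /= nm.
have [_ ylarge ymax] := yP n; have [_ /= hump] := sP (n, u n).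
set P := p n (y n) in ylarge ymax hump.
pose t : R := 3^-1 ^+ n.
have step i : p n (u i.+1 - u i) <= 3^-1 ^+ i * (3 / 2 * P).
  rewrite us seminormZ //; have [-> _] := sP (i, u i).
  rewrite ler_wpM2l ?exprn_ge0 ?invr_ge0 //.
  by apply: ymax; have [] := yP i.
have := seminorm_geometric_steps _ _ _ (sp n) step _ _ nm.
rewrite -seminorm_distC // exprSr -/t => tail.
have tri := seminorm_triangle (sp n) (u m) (u n.+1 - u m).
rewrite subrKC in tri.
have tP : 4 * c n <= t * P.
  rewrite /t exprVn -ler_pdivrMl ?invr_gt0 ?exprn_gt0 // invrK.
  by rewrite mulrCA mulrA ltW.
rewrite -/(u n.+1) -/t in hump.
(* The tail is at most 3/2 * 1/3 * 3/2 = 3/4 of [t * P]; the remaining quarter is at least [c n] by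
   [tP]. *)
lra.
Qed.

End MackeyCompleteness.

(** * Orbits of the semigroup and exponential decay *)

Section Semigroup.
Context {R : realType} {k : scalar_kind} {X : tvsType (scalars R k)}.
Context {G : set (X -> R)} {T : R -> X -> X}.
Context (G_det : determining_seminorms G) (T_sg : C0_semigroup T).
Implicit Types (q : X -> R) (B : set X) (x y : X).

Lemma seminorm_exp_rescaled q (w t : R) x : seminorm q ->
  q (exp_rescaled w T t x) = expR (w * t) * q (T t x).
Proof. by move=> sq; rewrite seminormZ // ger0_norm ?expR_ge0. Qed.

(** Convergence gives the bound 1 at late times, and strong continuity on a compact interval handles
    the rest; [C] adds the two bounds. *)
Lemma orbit_bounded q (w : R) x : G q -> 0 < w ->
  q (exp_rescaled w T t x) @[t --> +oo] --> 0 ->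
  exists C : R, forall t, 0 <= t -> expR (w * t) * q (T t x) <= C.
Proof.
move=> Gq w0 qT0; have sq := determining_seminorm G_det Gq.
have cq : continuous q by exact: (determining_continuous G_det).
have [a [_ qa]] := cvgr_lt 0 qT0 1 ltr01.
(* The threshold [a] may be negative. *)
pose b := Num.max 0 a.
have b0 : 0 <= b by rewrite le_max lexx.
have cT : {within `[0, b], continuous (fun t => q (T t x))}.
  apply/subspace_continuousP => t /=; rewrite in_itv /= => /andP[t0 tb].
  have Tt : T r x @[r --> within `[0, b] (nbhs t)] --> T t x.
    move=> U /(@C0_strong_continuity _ _ _ _ T_sg t x t0); apply: within_subset.
    by move=> r /=; rewrite in_itv /= => /andP[].
  exact: (cvg_comp _ _ Tt (cq (T t x))).
have [d _ dmax] := EVT_max b0 cT.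
exists (expR (w * b) * q (T d x) + 1) => t t0.
have [tb|bt] := leP t b.
  apply: (@le_trans _ _ (expR (w * b) * q (T d x))); last by rewrite lerDl.
  rewrite ler_pM ?expR_ge0 ?seminorm_ge0 //.
    by rewrite ler_expR ler_wpM2l // ltW.
  by apply: dmax; rewrite in_itv /= t0.
rewrite -seminorm_exp_rescaled //; apply: ltW.
apply: (@lt_le_trans _ _ 1).
  by apply: qa; apply: le_lt_trans bt; rewrite le_max lexx orbT.
by rewrite lerDr mulr_ge0 ?expR_ge0 ?seminorm_ge0.
Qed.

(** The unspent half of the rate bounds the supremum by [C * expR (- (w / 2 * t))], which tends to
    0. *)
Lemma exp_decay_on q B (w C : R) : seminorm q -> 0 < w ->
  (forall x t, B x -> 0 <= t -> expR (w * t) * q (T t x) <= C) ->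
  sup_on q B (exp_rescaled (w / 2) T t) @[t --> +oo] --> 0.
Proof.
(* For empty [B] the supremum is 0 by convention; otherwise [x0] witnesses that it is
   nonnegative. *)
move=> sq w0 qC; have [->|/set0P[x0 Bx0]] := eqVneq B set0.
  rewrite /sup_on (_ : (fun _ => _) = cst 0); first exact: cvg_cst.
  by apply/funext => t; rewrite image_set0 sup0.
have w20 : 0 < w / 2 by rewrite divr_gt0.
have C0 : 0 <= C.
  apply: le_trans (qC x0 0 Bx0 (lexx _)).
  by rewrite mulr_ge0 ?expR_ge0 ?seminorm_ge0.
apply: (@squeeze_cvgr _ _ _ _ (cst 0) (fun t => C * expR (- (w / 2 * t)))).
- exists 0; split=> // t t0.
  have ub : ubound [set q (exp_rescaled (w / 2) T t x) | x in B]
      (C * expR (- (w / 2 * t))).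
    move=> _ [x Bx <-]; rewrite seminorm_exp_rescaled //.
    rewrite expRN ler_pdivlMr ?expR_gt0 // mulrAC -expRD -mulrDl -splitr.
    by apply: qC => //; exact: ltW.
  apply/andP; split; last first.
    by apply: ge_sup ub; exists (q (exp_rescaled (w / 2) T t x0)), x0.
  apply: le_trans (seminorm_ge0 sq (exp_rescaled (w / 2) T t x0)) _.
  by apply: ub_le_sup; [exists (C * expR (- (w / 2 * t))) | exists x0].
- exact: cvg_cst.
- rewrite -(mulr0 C); apply: cvgMr.
  apply: (cvg_comp (fun t => w / 2 * t) (fun t => expR (- t))) (@cvgr_expR R).
  by apply: gt0_cvgMry => //; exact: cvg_id.
Qed.

(** A uniform boundedness principle in which Mackey completeness, through the gliding hump, replaces
    a Baire argument. *)
Lemma uniform_exp_bound q B (w : nat -> R) : mackey_complete X -> G q ->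
  {homo w : n m / (n <= m)%N >-> m <= n} ->
  (forall x, exists n, exists C : R,
    forall t, 0 <= t -> expR (w n * t) * q (T t x) <= C) ->
  von_neumann_bounded B ->
  exists n, exists C : R, forall x t, B x -> 0 <= t ->
    expR (w n * t) * q (T t x) <= C.
Proof.
move=> mcX Gq wmono ptw bB; have sq := determining_seminorm G_det Gq.
have cq : continuous q by exact: (determining_continuous G_det).
apply: contrapT => unbounded.
(* Failure of the bound for rate [w n] with constant [4 * 3 ^+ n * n%:R], the size that the gliding
   hump needs to reach [n]. *)
have /choice[t tP] n : exists t : R, 0 <= t /\
    exists2 y, B y & 4 * 3 ^+ n * n%:R < expR (w n * t) * q (T t y).
  apply: contrapT => bounded; apply: unbounded.
  exists n, (4 * 3 ^+ n * n%:R) => x t Bx t0.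
  rewrite leNgt; apply/negP => lt; apply: bounded.
  by exists t; split=> //; exists x.
pose p n x := expR (w n * t n) * q (T (t n) x).
have [//|n|n|//|n|n|x px] := @gliding_hump _ _ _ _ G_det p (fun n => n%:R) B.
- have [t0 _] := tP n; have [linT _] := C0_continuous_linear T_sg t0.
  by apply: seminorm_comp => //; exact: expR_ge0.
- have [t0 _] := tP n; have [_ cT] := C0_continuous_linear T_sg t0.
  move=> x; apply: cvgMr.
  exact: (cvg_comp _ _ (cT x) (cq _)).
- by [].
- by have [] := tP n.
have [n [C xC]] := ptw x.
(* As [m >= n], the rate [w m] is at most [w n], so the orbit bound [C] also limits [p m x], which
   is at least [m]. *)
have [m nm Cm] : exists2 m, (n <= m)%N & C < m%:R.
  exists (maxn n (Num.bound `|C|)); first exact: leq_maxl.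
  apply: le_lt_trans (ler_norm C) _.
  apply: lt_le_trans (archi_boundP (normr_ge0 C)) _.
  by rewrite ler_nat leq_maxr.
have [t0 _] := tP m.
have := lt_le_trans Cm (px m); rewrite ltNge => /negP; apply.
apply: le_trans (xC _ t0); rewrite ler_wpM2r ?seminorm_ge0 //.
by rewrite ler_expR ler_wpM2r // wmono.
Qed.

Lemma sup_on1 q (S : X -> X) x : sup_on q [set x] S = q (S x).
Proof. by rewrite /sup_on image_set1 sup1. Qed.

End Semigroup.

Theorem theorem2p6 (R : realType) (k : scalar_kind)
    (X : tvsType (scalars R k)) (G : set (X -> R)) (T : R -> X -> X)
    (X_hausdorff : hausdorff_space X)
    (G_determining : determining_seminorms G)
    (X_complete : mackey_complete X)
    (T_semigroup : C0_semigroup T) :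
  (pseudo_uniformly_exp_stable G T <->
   (forall q, G q -> exists2 w : R, 0 < w &
      forall x, q (exp_rescaled w T t x) @[t --> +oo] --> 0))
  /\
  (pseudo_strongly_exp_stable G T <->
   (forall q B, G q -> von_neumann_bounded B -> exists2 w : R, 0 < w &
      sup_on q B (exp_rescaled w T t) @[t --> +oo] --> 0)).
Proof.
split; split.
- move=> stable q Gq; have [w w0 qw] := stable q Gq; exists w => // x.
  have := qw _ (von_neumann_bounded1 G_determining x).
  by under eq_fun do rewrite sup_on1.
- move=> stable q Gq; have [w w0 qw] := stable q Gq.
  exists (w / 2) => [|B bB]; first by rewrite divr_gt0.
  have [|_ [C wC]] := uniform_exp_bound G_determining T_semigroup q B
    (fun=> w) X_complete Gq (fun _ _ _ => lexx w) _ bB.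
    by move=> x; exists 0%N; exact: (orbit_bounded G_determining T_semigroup).
  exact: exp_decay_on (determining_seminorm G_determining Gq) w0 wC.
- move=> stable q B Gq bB.
  (* The rate may vary with the orbit; this sequence decreases to 0 and so has a term below any of
     them. *)
  pose w n : R := n.+1%:R^-1.
  have wmono : {homo w : n m / (n <= m)%N >-> m <= n}.
    by move=> n m nm; rewrite lef_pV2 ?posrE // ler_nat.
  have [|n [C wC]] := uniform_exp_bound G_determining T_semigroup q B
    w X_complete Gq wmono _ bB.
    move=> x; have [v v0 qv] := stable q x Gq.
    have [C vC] := orbit_bounded G_determining T_semigroup q v x Gq v0 qv.
    have [n nv] : exists n, w n <= v.
      exists (Num.bound v^-1); rewrite invf_ple ?posrE //.
      apply: le_trans (ltW (archi_boundP _)) _; first by rewrite invr_ge0 ltW.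
      by rewrite ler_nat.
    exists n, C => t t0; apply: le_trans (vC t t0).
    have q0 := seminorm_ge0 (determining_seminorm G_determining Gq).
    by rewrite ler_wpM2r // ler_expR ler_wpM2r.
  exists (w n / 2); first by rewrite divr_gt0 ?invr_gt0.
  apply: exp_decay_on wC; last by rewrite invr_gt0.
  exact: determining_seminorm Gq.
- move=> stable q x Gq.
  have [w w0 qw] := stable q _ Gq (von_neumann_bounded1 G_determining x).
  exists w => //; move: qw.
  by under eq_fun do rewrite sup_on1.
Qed.
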